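(* There is no non-trivial congruence distributive variety of involutory quandles; that is, every congruence distributive variety all of whose members are involutory quandles consists only of one-element algebras.
   Context: A quandle is an algebra $(Q,*,\backslash)$ with two binary operations satisfying $x*(x\backslash y)\approx y\approx x\backslash(x*y)$, $x*x\approx x$ and $x*(y*z)\approx(x*y)*(x*z)$. A quandle is involutory if $x*(x*y)\approx y$ holds. A variety is congruence distributive if all its members have distributive congruence lattices. *)

(* Defs.v *)
From HB Require Import structures.
From mathcomp Require Import all_boot all_order.
From mathcomp Require Import boolp.

Set Implicit Arguments.
Unset Strict Implicit.
Unset Printing Implicit Defensive.

(* Algebras (Q, *, \) of type (2, 2); as usual in universal algebra, the
   carrier is non-empty. *)
Record algebra := Algebra {
  carrier :> Type;
  op : carrier -> carrier -> carrier;
  ldiv : carrier -> carrier -> carrier;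
  algebra_nonempty : inhabited carrier
}.

Declare Scope quandle_scope.
Delimit Scope quandle_scope with Qdl.
Notation "x * y" := (op x y) : quandle_scope.
Notation "x \ y" := (ldiv x y) (at level 40, left associativity) : quandle_scope.

Definition quandle (Q : algebra) : Prop :=
  [/\ forall x y : Q, (x * (x \ y) = y /\ x \ (x * y) = y)%Qdl,
      forall x : Q, (x * x = x)%Qdl
    & forall x y z : Q, (x * (y * z) = (x * y) * (x * z))%Qdl].

Definition involutory_quandle (Q : algebra) : Prop :=
  quandle Q /\ forall x y : Q, (x * (x * y) = y)%Qdl.

Definition homomorphism (A B : algebra) (f : A -> B) : Prop :=
  forall x y : A, (f (x * y) = f x * f y /\ f (x \ y) = f x \ f y)%Qdl.

Lemma product_nonempty (I : Type) (F : I -> algebra) :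
  inhabited (forall i, F i).
Proof.
constructor=> i.
have /cid[x _] : exists x : F i, True by case: (algebra_nonempty (F i)) => x; exists x.
exact: x.
Qed.

Definition product (I : Type) (F : I -> algebra) : algebra :=
  @Algebra (forall i, F i)
    (fun x y i => (x i * y i)%Qdl) (fun x y i => (x i \ y i)%Qdl)
    (product_nonempty F).

(* Subalgebras are taken up to isomorphism, as the domains of embeddings. *)
Record variety (V : algebra -> Prop) : Prop := Variety {
  variety_image : forall (A B : algebra) (f : A -> B), homomorphism f ->
    (forall y : B, exists x : A, f x = y) -> V A -> V B;
  variety_sub : forall (A B : algebra) (f : A -> B), homomorphism f ->
    injective f -> V B -> V A;
  variety_product : forall (I : Type) (F : I -> algebra),
    (forall i, V (F i)) -> V (product F)
}.

Record congruence (A : algebra) := Congruence {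
  cong :> A -> A -> Prop;
  cong_refl : forall x, cong x x;
  cong_sym : forall x y, cong x y -> cong y x;
  cong_trans : forall x y z, cong x y -> cong y z -> cong x z;
  cong_op : forall x x' y y', cong x x' -> cong y y' ->
    cong (x * y)%Qdl (x' * y')%Qdl;
  cong_ldiv : forall x x' y y', cong x x' -> cong y y' ->
    cong (x \ y)%Qdl (x' \ y')%Qdl
}.

Fact congruence_display : Order.disp_t.
Proof. exact: Order.Disp tt tt. Qed.

Section CongruenceLattice.
Variable A : algebra.
Implicit Types a b c : congruence A.

HB.instance Definition _ := gen_eqMixin (congruence A).
HB.instance Definition _ := gen_choiceMixin (congruence A).

Definition cong_sub a b : Prop := forall x y, a x y -> b x y.

Lemma congruence_ext a b : cong_sub a b -> cong_sub b a -> a = b.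
Proof.
case: a b => [r r1 r2 r3 r4 r5] [s s1 s2 s3 s4 s5] rs sr.
have E : r = s by apply/funext => x; apply/funext => y; apply/propext; split;
  [exact: rs | exact: sr].
by case: _ / E in s1 s2 s3 s4 s5 rs sr *; congr Congruence; apply: Prop_irrelevance.
Qed.

Definition cong_meet a b : congruence A.
Proof.
exists (fun x y => a x y /\ b x y).
- by move=> x; split; apply: cong_refl.
- by move=> x y [? ?]; split; apply: cong_sym.
- by move=> x y z [? ?] [? ?]; split; apply: (@cong_trans _ _ _ y).
- by move=> x x' y y' [? ?] [? ?]; split; apply: cong_op.
- by move=> x x' y y' [? ?] [? ?]; split; apply: cong_ldiv.
Defined.

(* The least congruence containing both a and b. *)
Definition cong_join a b : congruence A.
Proof.
exists (fun x y => forall c, cong_sub a c -> cong_sub b c -> c x y).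
- by move=> x c _ _; apply: cong_refl.
- by move=> x y xy c ac bc; apply: cong_sym; apply: xy.
- move=> x y z xy yz c ac bc.
  by apply: (@cong_trans _ _ _ y); [apply: xy | apply: yz].
- by move=> x x' y y' xx yy c ac bc; apply: cong_op; [apply: xx | apply: yy].
- by move=> x x' y y' xx yy c ac bc; apply: cong_ldiv; [apply: xx | apply: yy].
Defined.

Definition cong_le a b : bool := `[< cong_sub a b >].

Lemma cong_le_refl : reflexive cong_le.
Proof. by move=> a; apply/asboolP. Qed.

Lemma cong_le_anti : antisymmetric cong_le.
Proof. by move=> a b /andP[/asboolP ab /asboolP ba]; apply: congruence_ext. Qed.

Lemma cong_le_trans : transitive cong_le.
Proof.
by move=> b a c /asboolP ab /asboolP bc; apply/asboolP => x y /ab /bc.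
Qed.

HB.instance Definition _ := Order.Le_isPOrder.Build congruence_display
  (congruence A) cong_le_refl cong_le_anti cong_le_trans.

Lemma cong_meetP a b c :
  (a <= cong_meet b c)%O = (a <= b)%O && (a <= c)%O.
Proof.
apply/asboolP/andP => [abc | [/asboolP ab /asboolP ac] x y axy].
  by split; apply/asboolP => x y /abc[].
by split; [apply: ab | apply: ac].
Qed.

Lemma cong_joinP a b c :
  (cong_join a b <= c)%O = (a <= c)%O && (b <= c)%O.
Proof.
apply/asboolP/andP => [abc | [/asboolP ac /asboolP bc] x y]; last exact.
split; apply/asboolP => x y h; apply: abc => d ad bd.
  exact: ad.
exact: bd.
Qed.

HB.instance Definition _ := Order.POrder_MeetJoin_isLattice.Build
  congruence_display (congruence A) cong_meetP cong_joinP.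

End CongruenceLattice.

Definition congruence_distributive (V : algebra -> Prop) : Prop :=
  forall A : algebra, V A ->
    right_distributive (@Order.meet _ (congruence A)) (@Order.join _ (congruence A)).

Definition one_element (A : algebra) : Prop := exists x : A, forall y : A, y = x.

(* Main.v *)
Require Import Defs.
From mathcomp Require Import all_boot all_order all_algebra.
From mathcomp Require Import boolp zify ring.

(**
Two elements a, b of an involutory quandle extend to a sequence f indexed by
the integers with f 0 = a, f 1 = b and f i * f j = f (2 i - j). The translates
k |-> f (k + i) form a subalgebra of a power of the quandle which is isomorphic
to the core x * y = 2 x - y of a cyclic group, and this group is non-trivial as
soon as a <> b. Since the core is an affine algebra, the addition of the group
is a homomorphism from its square; its kernel and the kernels of the two
projections then violate distributivity.
*)

Set Implicit Arguments.
Unset Strict Implicit.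

Section Kernel.
Variables (A B : algebra) (f : A -> B).
Hypothesis f_hom : homomorphism f.

Definition kernel : congruence A.
Proof.
exists (fun x y => f x = f y) => //.
- by move=> x y z ->.
- by move=> x x' y y' ex ey; rewrite !(f_hom _ _).1 ex ey.
- by move=> x x' y y' ex ey; rewrite !(f_hom _ _).2 ex ey.
Defined.

End Kernel.

Lemma proj_homomorphism (I : Type) (F : I -> algebra) (i : I) :
  homomorphism (fun x : product F => x i).
Proof. by []. Qed.

(** The kernel of [m] meets each projection kernel in equality, hence by distributivity also meets
    their join in equality. That join relates (x, y) to (y, x) through (x, x). *)
Lemma symmetric_pair_eq (A B : algebra)
    (m : product (fun _ : bool => A) -> B) :
  right_distributive
    (@Order.meet _ (congruence (product (fun _ : bool => A)))) (@Order.join _ _) ->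
  homomorphism m ->
  (forall p q, m p = m q -> forall i, p i = q i -> p = q) ->
  forall x y : A, m (fun i => if i then x else y) = m (fun i => if i then y else x) ->
  x = y.
Proof.
move=> distr m_hom m_inj x y mxy.
pose P := product (fun _ : bool => A).
pose eta i : congruence P := kernel (@proj_homomorphism bool (fun _ => A) i).
pose theta : congruence P := kernel m_hom.
pose p : P := fun i => if i then x else y.
pose q : P := fun i => if i then y else x.
have : cong_meet theta (cong_join (eta true) (eta false)) p q.
  split=> // c etac etac'.
  apply: (@cong_trans _ c _ (fun _ => x)); first exact: etac.
  exact: etac'.
have -> : cong_meet theta (cong_join (eta true) (eta false)) =
    cong_join (cong_meet theta (eta true)) (cong_meet theta (eta false)).
  exact: distr.
have idhom : homomorphism (@id P) by [].
(* The kernel of the identity is equality, taken here as an upper bound of the two meets. *)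
move=> /(_ (kernel idhom)) pq.
suff /(congr1 (@^~ true)) : p = q by [].
by apply: pq => u v [muv uvi]; apply: m_inj uvi.
Qed.

Lemma involutory_ldiv (Q : algebra) : involutory_quandle Q ->
  forall x y : Q, (x \ y = x * y)%Qdl.
Proof. by move=> [[ldivK _ _] invol] x y; rewrite -{1}(invol x y) (ldivK _ _).2. Qed.

Section DihedralSequence.
Variables (Q : algebra) (Q_inv : involutory_quandle Q).

Let invol (x y : Q) : (x * (x * y) = y)%Qdl. Proof. exact: Q_inv.2. Qed.

Fixpoint dihedral_nat (a b : Q) (n : nat) : Q :=
  if n is n'.+1 then dihedral_nat b (b * a)%Qdl n' else a.

Lemma dihedral_natSS n : forall a b, dihedral_nat a b n.+2 =
  (dihedral_nat a b n.+1 * dihedral_nat a b n)%Qdl.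
Proof. by elim: n => // n IHn a b; apply: IHn. Qed.

Variables a b : Q.

(** [Negz k] is -(k+1). Negative indices come from running the recursion backwards from b, a, whose
    term m has index 1 - m. *)
Definition dihedral (n : int) : Q :=
  match n with Posz k => dihedral_nat a b k | Negz k => dihedral_nat b a k.+2 end.

Import GRing.Theory.
Local Open Scope ring_scope.

Lemma dihedral_rec n : dihedral (n + 2) = (dihedral (n + 1) * dihedral n)%Qdl.
Proof.
case: n => k.
  have -> : k%:Z + 2 = k.+2 by lia.
  have -> : k%:Z + 1 = k.+1 by lia.
  exact: dihedral_natSS.
rewrite [dihedral (Negz k)]/dihedral dihedral_natSS.
have -> : dihedral (Negz k + 1) = dihedral_nat b a k.+1.
  by case: k => // k; have -> : Negz k.+1 + 1 = Negz k by lia.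
(* For k = 0 and k = 1 the index [Negz k + 2] is 1 and 0, where the two branches of [dihedral]
   meet. *)
rewrite invol; case: k => [|[|k]] //.
by have -> : Negz k.+2 + 2 = Negz k by lia.
Qed.

(** Left multiplication by [dihedral n] is an endomorphism, so it carries the forward recurrence to
    the backward one; induction on k follows. *)
Lemma dihedral_reflect n (k : nat) :
  (dihedral n * dihedral (n + k%:Z))%Qdl = dihedral (n - k%:Z).
Proof.
have [[_ idem distr] _] := Q_inv.
have rec' i : dihedral i = (dihedral (i + 1) * dihedral (i + 2))%Qdl.
  by rewrite dihedral_rec invol.
elim/ltn_ind: k => -[|[|k]] IHk.
- by rewrite addr0 idem; congr dihedral; lia.
- rewrite [RHS]rec' subrK; congr (_ * dihedral _)%Qdl; ring.
rewrite (_ : n + k.+2%:Z = n + k%:Z + 2); last lia.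
rewrite dihedral_rec distr (_ : n + k%:Z + 1 = n + k.+1%:Z); last lia.
rewrite !IHk // [RHS]rec'; congr (dihedral _ * dihedral _)%Qdl; lia.
Qed.

Lemma dihedral_op i j : (dihedral i * dihedral j)%Qdl = dihedral (2 * i - j).
Proof.
have [k [->|->]] : exists k : nat, j = i + k%:Z \/ j = i - k%:Z.
- by exists `|j - i|%N; lia.
- by rewrite dihedral_reflect; congr dihedral; ring.
(* Here j = i - k: the reflection is its own inverse. *)
by rewrite -dihedral_reflect invol; congr dihedral; ring.
Qed.

Local Notation power := (product (fun _ : int => Q)).

Definition translate (n : int) : power := fun k => dihedral (k + n).

Lemma translate_op i j : (translate i * translate j)%Qdl = translate (2 * i - j).
Proof. by apply/funext => k; rewrite /= dihedral_op; congr dihedral; ring. Qed.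

(** Single terms of the sequence may coincide without their successors doing so. Equality of whole
    translates is shift-invariant, so it makes the indices a quotient group of the integers. *)
Lemma translateD k i j : translate i = translate j ->
  translate (i + k) = translate (j + k).
Proof.
move=> ij; apply/funext => l; have := congr1 (@^~ (l + k)) ij.
by rewrite /translate addrAC -addrA => ->; congr dihedral; ring.
Qed.

Definition translates : Type := {u : power | exists n, u = translate n}.

Definition translates_op (u v : translates) : translates.
Proof.
exists (sval u * sval v)%Qdl.
case: u v => [_ /= [i ->]] [_ /= [j ->]].
by exists (2 * i - j); apply: translate_op.
Defined.

(* Division is multiplication, since the quandle is involutory. *)
Definition cyclic_core : algebra :=
  @Algebra translates translates_op translates_op
    (inhabits (exist _ (translate 0) (ex_intro _ 0 erefl))).

Lemma sval_translates_inj : injective (sval : cyclic_core -> power).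
Proof. by move=> [u pu] [v pv] /= uv; apply: eq_exist. Qed.

Lemma power_ldiv (u v : power) : (u \ v = u * v)%Qdl.
Proof. by apply/funext => k; apply: involutory_ldiv. Qed.

Lemma sval_translates_hom : homomorphism (sval : cyclic_core -> power).
Proof. by move=> u v; split=> //; rewrite power_ldiv. Qed.

Definition index (u : cyclic_core) : int := sval (cid (svalP u)).

Lemma translate_index u : translate (index u) = sval u.
Proof. by rewrite /index; case: cid. Qed.

Lemma translate_index_op u v :
  translate (index (u * v)%Qdl) = translate (2 * index u - index v).
Proof. by rewrite -translate_op !translate_index. Qed.

(** Addition of the cyclic group, computed on chosen representatives. *)
Definition core_sum (p : product (fun _ : bool => cyclic_core)) : power :=
  translate (index (p true) + index (p false)).

Lemma core_sum_hom : homomorphism core_sum.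
Proof.
move=> p q.
suff E : core_sum (p * q)%Qdl = (core_sum p * core_sum q)%Qdl.
  by split=> //; rewrite power_ldiv.
(* The index of a product is 2i - j only up to equality of translates, so the summands are replaced
   one at a time under [translate]. *)
rewrite /core_sum translate_op (translateD _ (translate_index_op _ _)) addrC.
rewrite (translateD _ (translate_index_op _ _)); congr translate; ring.
Qed.

(** Cancellation in the group: the common summand is subtracted. *)
Lemma core_sum_inj p q : core_sum p = core_sum q -> forall i, p i = q i -> p = q.
Proof.
move=> pq i pqi; apply/funext => j.
have [<-//|ij] := eqVneq i j.
apply: sval_translates_inj; rewrite -!translate_index.
move: pq; rewrite /core_sum.
case: i j ij pqi => -[] // _ -> /(translateD (- _)).
  by move=> /(_ (index (q true))); rewrite ![index (q true) + _]addrC !addrK.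
by move=> /(_ (index (q false))); rewrite !addrK.
Qed.

Lemma cyclic_core_nontrivial : a <> b -> exists u v : cyclic_core, u <> v.
Proof.
move=> ab.
exists (exist _ (translate 0) (ex_intro _ 0 erefl)).
exists (exist _ (translate 1) (ex_intro _ 1 erefl)).
(* At position 0 the two translates take the values a and b. *)
by move=> /(congr1 (fun u => sval u 0)).
Qed.

End DihedralSequence.

Theorem corollary4p11 (V : algebra -> Prop)
  (V_variety : variety V)
  (V_involutory : forall Q : algebra, V Q -> involutory_quandle Q)
  (V_distributive : congruence_distributive V) :
  forall Q : algebra, V Q -> one_element Q.
Proof.
move=> Q VQ; case: (algebra_nonempty Q) => b; exists b => a.
apply: contrapT => /(cyclic_core_nontrivial (V_involutory _ VQ))[u [v]]; apply.
have V_core : V (cyclic_core (V_involutory _ VQ) a b).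
  apply: (variety_sub V_variety (@sval_translates_hom _ _ a b)).
    exact: sval_translates_inj.
  exact: variety_product.
apply: (symmetric_pair_eq _ (@core_sum_hom _ _ a b)).
- by apply: V_distributive; apply: variety_product.
- exact: core_sum_inj.
(* Commutativity of addition gives (u, v) and (v, u) the same sum. *)
by rewrite /core_sum GRing.addrC.
Qed.
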